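(* Let $A\in\mathbb{R}^{n\times n}$ be symmetric with eigenvalues $\alpha_1\ge\cdots\ge\alpha_n$, $g\in\mathbb{R}^n$ nonzero, $\Delta>0$, and consider the TRS of minimizing $\frac12x^TAx+x^Tg$ subject to $\|x\|\le\Delta$, in the easy case. With the notation of the context, suppose $\|x_{opt}\|=\|x_k\|=\Delta$, $k\in\{1,\ldots,k_{\max}\}$. Let $y=(y_1^T,y_2^T)^T\in\mathbb{R}^{2n}$ ($y_1,y_2\in\mathbb{R}^n$) be a unit-length eigenvector of $M$ associated with $\lambda_{opt}$, and define $$\tilde h_k=-\|g\|(T_k+\lambda_{opt}I)^{-1}e_1,\quad\tilde x_k=Q_k\tilde h_k,\quad\tilde r_k=(A+\lambda_{opt}I)\tilde x_k+g,\quad s_k=\frac{\|A_{opt}^{-1}x_{opt}\|}{\|g\|\,e_1^T(T_k+\lambda_{opt}I)^{-3}e_1}.$$ Then $$\lambda_{opt}-\lambda_k\le s_k\frac{\|\tilde r_k\|}{\|g\|}\sin\angle(y_2,\mathcal{K}_k)\le s_k\frac{2\beta_k\Delta}{\|y_2\|\|g\|}\Big(\frac{\sqrt\kappa-1}{\sqrt\kappa+1}\Big)^{k-1}\sin\angle(y,\widetilde{\mathcal{S}}_k),$$ where $\mathcal{K}_k=\mathcal{K}_k(A,g)$.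
   Context: Norms are Euclidean. $x_{opt}$ is a global minimizer of the TRS with multiplier $\lambda_{opt}\ge0$ ($(A+\lambda_{opt}I)x_{opt}=-g$, $\lambda_{opt}(\Delta-\|x_{opt}\|)=0$, $A+\lambda_{opt}I\succeq0$); easy case: $\lambda_{opt}>-\alpha_n$. $A_{opt}=A+\lambda_{opt}I$, $\kappa=(\alpha_1+\lambda_{opt})/(\alpha_n+\lambda_{opt})$. $M=\begin{pmatrix}-A&gg^T/\Delta^2\\ I&-A\end{pmatrix}$; when $\|x_{opt}\|=\Delta$, $\lambda_{opt}$ is the rightmost eigenvalue of $M$. Lanczos on $A$ with start $g$: $Q_k=[q_1,\ldots,q_k]$ orthonormal basis of $\mathcal{K}_k(A,g)=\mathrm{span}\{g,\ldots,A^{k-1}g\}$, $q_1=g/\|g\|$, $T_k=Q_k^TAQ_k$ tridiagonal, $AQ_k=Q_kT_k+\beta_kq_{k+1}e_k^T$, $k_{\max}$ the first breakdown step. GLTR: $x_k=Q_kh_k$, $h_k$ minimizes $\frac12h^TT_kh+\|g\|h^Te_1$ over $\|h\|\le\Delta$, multiplier $\lambda_k\ge0$ with $(T_k+\lambda_kI)h_k=-\|g\|e_1$, $\lambda_k(\Delta-\|h_k\|)=0$, $T_k+\lambda_kI\succeq0$. $\widetilde{\mathcal{S}}_k$ is the range of $\mathrm{diag}(Q_k,Q_k)\in\mathbb{R}^{2n\times2k}$. For nonzero $p$ and subspace $\mathcal{W}$ with orthonormal basis $W$, $\sin\angle(p,\mathcal{W})=\|(I-WW^T)p\|/\|p\|$.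 *)

(* Defs.v *)
From HB Require Import structures.
From mathcomp Require Import all_boot all_order all_algebra.
Set Implicit Arguments. Unset Strict Implicit. Unset Printing Implicit Defensive.
Import Order.TTheory GRing.Theory Num.Theory.
Local Open Scope ring_scope.

Section TRSDefs.
Variable R : rcfType.

Definition vnorm m (v : 'cV[R]_m) : R := Num.sqrt (\sum_i (v i 0) ^+ 2).

Definition symmetric_mx n (A : 'M[R]_n) := A^T = A.
Definition psd n (B : 'M[R]_n) := forall v : 'cV[R]_n, 0 <= (v^T *m B *m v) 0 0.

Definition e_first k : 'cV[R]_k := \col_(i < k) ((i : nat) == 0%N)%:R.
Definition e_last k : 'cV[R]_k := \col_(i < k) ((i : nat) == k.-1)%:R.

Definition trs_obj n (A : 'M[R]_n) (g : 'cV[R]_n) (x : 'cV[R]_n) : R :=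
  2^-1 * (x^T *m A *m x) 0 0 + (x^T *m g) 0 0.

Definition trs_solution n (A : 'M[R]_n) (g : 'cV[R]_n) (D : R)
    (x : 'cV[R]_n) (lam : R) :=
  [/\ vnorm x <= D,
      forall z : 'cV[R]_n, vnorm z <= D -> trs_obj A g x <= trs_obj A g z,
      0 <= lam &
      [/\ (A + lam%:M) *m x = - g,
      lam * (D - vnorm x) = 0 &
      psd (A + lam%:M)]].

(* Krylov matrix: its row space is K_k(A,g) = span{g, Ag, ..., A^(k-1) g}
   (rows are the transposed vectors A^j g). *)
Definition krylov n (A : 'M[R]_n) (g : 'cV[R]_n) k : 'M[R]_(k, n) :=
  \matrix_(j < k, i < n) ((A ^+ j) *m g) i 0.

(* Q_k = [q_1,...,q_k]; the sequence q is 0-indexed: q 0 = q_1. *)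
Definition Qk n (q : nat -> 'cV[R]_n) k : 'M[R]_(n, k) :=
  \matrix_(i < n, j < k) q j i 0.

Definition Tk n (A : 'M[R]_n) (q : nat -> 'cV[R]_n) k : 'M[R]_k :=
  (Qk q k)^T *m A *m Qk q k.

(* beta_k: from A Q_k = Q_k T_k + beta_k q_{k+1} e_k^T (beta_k >= 0),
   i.e. beta_k = || (A Q_k - Q_k T_k) e_k || *)
Definition betak n (A : 'M[R]_n) (q : nat -> 'cV[R]_n) k : R :=
  vnorm ((A *m Qk q k - Qk q k *m Tk A q k) *m e_last k).

(* the Lanczos process on A started with g produces q, and kmax is
   the first breakdown step *)
Definition lanczos n (A : 'M[R]_n) (g : 'cV[R]_n) (q : nat -> 'cV[R]_n)
    (kmax : nat) :=
  [/\ (0 < kmax)%N,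
      q 0%N = (vnorm g)^-1 *: g &
      [/\ (Qk q kmax)^T *m Qk q kmax = 1%:M,
      (forall j, (j <= kmax)%N -> ((Qk q j)^T == krylov A g j)%MS),
      (forall j, (1 <= j < kmax)%N -> betak A q j != 0) &
      betak A q kmax = 0]].

(* sin of the angle between p and the range of W (W orthonormal columns) *)
Definition sin_angle m p (W : 'M[R]_(m, p)) (v : 'cV[R]_m) : R :=
  vnorm ((1%:M - W *m W^T) *m v) / vnorm v.

Definition Mmat n (A : 'M[R]_n) (g : 'cV[R]_n) (D : R) : 'M[R]_(n + n) :=
  block_mx (- A) ((D ^+ 2)^-1 *: (g *m g^T)) 1%:M (- A).

Definition Qk2 n (q : nat -> 'cV[R]_n) k : 'M[R]_(n + n, k + k) :=
  block_mx (Qk q k) 0 0 (Qk q k).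

End TRSDefs.

(* Main.v *)
Require Import Defs.
From HB Require Import structures.
From mathcomp Require Import all_boot all_order all_algebra.
From mathcomp Require Import complex ring lra.
Import Order.TTheory GRing.Theory Num.Theory.
Set Implicit Arguments. Unset Strict Implicit. Unset Printing Implicit Defensive.
Local Open Scope ring_scope.

(* Write B = A + lamopt I, T = Q^T B Q, x = xopt, xt = Q ht.  The function
   mu |-> |(T_k + mu I)^-1 f|^2 is convex, so the tangent at lamopt bounds
   lamopt - lamk by (|x|^2 - |xt|^2) / (2 |g|^2 e1^T T^-3 e1).  Galerkin
   orthogonality gives |x|^2 - |xt|^2 <= 2 <x - xt, x> = - 2 <rt, (I - Q Q^T) B^-1 x>,
   and y2 is a multiple of B^-1 x: this is the first inequality.

   For the second one, rt = (e_k^T ht) (A Q - Q T_k) e_k.  For every polynomial p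
   of degree < k with p(0) = 1, the vector ht - p(T) ht lies in the Krylov space
   of dimension k - 1, so e_k^T ht = e_k^T p(T) ht; a Chebyshev polynomial p
   gives |e_k^T ht| <= 2 rho^(k-1) |ht|, and |ht| <= |x| = D by the
   monotonicity of the norms of conjugate gradient iterates. *)

(** * Spectral decomposition of real symmetric matrices *)

Section Spectral.
Local Open Scope sesquilinear_scope.
Local Open Scope complex_scope.
Variable R : rcfType.

(** A real symmetric matrix is Hermitian over [R[i]], hence diagonalized by a unitary [P] with real
    eigenvalues; the weights are the squared moduli of the entries of [P *m v]. *)
Lemma symmetric_spectral_measure n (A : 'M[R]_n.+1) : symmetric_mx A ->
  exists2 d : 'I_n.+1 -> R, forall i, eigenvalue A (d i) &
    forall v : 'cV[R]_n.+1, exists2 w : 'I_n.+1 -> R, forall i, 0 <= w i &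
      forall p, (v^T *m (horner_mx A p *m v)) 0 0 = \sum_i p.[d i] * w i.
Proof.
move=> Asym; pose toC := real_complex R.
have conjR m1 m2 (B : 'M[R]_(m1, m2)) : map_mx Num.conj (map_mx toC B) = map_mx toC B.
  apply/matrixP=> i j; rewrite !mxE; apply/CrealP/complex_realP.
  by exists (B i j).
pose AC := map_mx toC A.
have hermA : AC \is hermsymmx.
  by apply/is_hermitianmxP; rewrite expr0 scale1r [AC^T]map_trmx Asym conjR.
have /hermitian_normalmx/orthomx_spectralP := hermA.
set P := spectralmx AC; set sp := spectral_diag AC => AE.
have Punit : P \in unitmx by exact: spectral_unit.
have Pinv : invmx P = P^t* by apply/invmx_unitary/spectral_unitarymx.
have spR i : toC (complex.Re (sp 0 i)) = sp 0 i.
  by apply: RRe_real; have /mxOverP := hermitian_spectral_diag_real hermA; apply.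
exists (fun i => complex.Re (sp 0 i)) => [i|v].
  (* Being a root of the characteristic polynomial descends along the embedding of [R]. *)
  rewrite eigenvalue_root_char -(fmorph_root toC) map_char_poly -eigenvalue_root_char.
  rewrite [X in eigenvalue _ X]spR; apply/eigenvalueP; exists (delta_mx 0 i *m P).
    rewrite [map_mx _ _]AE !mulmxA mulmxK // scalemxAl; congr (_ *m _).
    rewrite -rowE; apply/rowP=> j; rewrite !mxE eqxx /=.
    by rewrite [j == i]eq_sym; case: eqP => [->|]; rewrite /= ?mulr1 ?mulr0.
  apply/negP => /eqP/(congr1 (mulmx^~ (invmx P))).
  rewrite mulmxK // mul0mx => /matrixP/(_ 0 i)/eqP.
  by rewrite !mxE !eqxx oner_eq0.
pose u : 'cV_n.+1 := P *m map_mx toC v.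
exists (fun i => complex.Re (u i 0) ^+ 2 + complex.Im (u i 0) ^+ 2) => [i|p].
  by rewrite addr_ge0 ?sqr_ge0.
apply: (@complexI R); rewrite rmorph_sum.
transitivity ((map_mx toC (v^T *m (horner_mx A p *m v))) 0 0); first by rewrite [RHS]mxE.
rewrite !map_mxM map_horner_mx [map_mx _ A]AE horner_mx_uconjC //.
rewrite horner_mx_diag Pinv !mulmxA -[_ *m P *m _]mulmxA -/u.
have -> : map_mx toC v^T *m P^t* = u^t*.
  by rewrite trmx_mul map_mxM map_trmx conjR.
rewrite -mulmxA mul_diag_mx mxE; apply: eq_bigr => i _.
rewrite !mxE rmorphM -{1}spR (horner_map toC) mulrCA; congr (_ * _).
by rewrite -normCKC [RHS]add_Re2_Im2.
Qed.

End Spectral.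

(** * Chebyshev polynomials and their residual bound on an interval *)

Section Chebyshev.
Variable R : rcfType.

(* The pair [(T_m(x), U_(m-1)(x))] of Chebyshev polynomials of both kinds; it
   satisfies Pell's equation [T^2 + (1 - x^2) U^2 = 1], which bounds [T] on
   [-1, 1] without trigonometry. *)
Fixpoint chebyshev (x : {poly R}) m : {poly R} * {poly R} :=
  if m is m'.+1 then
    let: (t, u) := chebyshev x m' in (x * t - (1 - x ^+ 2) * u, x * u + t)
  else (1, 0).

Lemma chebyshev_pell (x : {poly R}) m :
  (chebyshev x m).1 ^+ 2 + (1 - x ^+ 2) * (chebyshev x m).2 ^+ 2 = 1.
Proof.
elim: m => [|m] /=; first by rewrite expr1n expr0n mulr0 addr0.
case: (chebyshev x m) => t u /= E; rewrite -[RHS]E; ring.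
Qed.

Lemma chebyshev_le1 (x : {poly R}) (s : R) m :
  x.[s] ^+ 2 <= 1 -> `|(chebyshev x m).1.[s]| <= 1.
Proof.
move=> xs; have := congr1 (horner^~ s) (chebyshev_pell x m).
rewrite -polyC1 !(hornerD, hornerN, hornerM, horner_exp, hornerC) => E.
rewrite -(@ler_pXn2r _ 2) ?nnegrE // real_normK ?num_real // expr1n -E.
by rewrite lerDl mulr_ge0 ?subr_ge0 ?sqr_ge0.
Qed.

Lemma size_chebyshev (x : {poly R}) m : (size x <= 2)%N ->
  (size (chebyshev x m).1 <= m.+1)%N /\ (size (chebyshev x m).2 <= m)%N.
Proof.
move=> sx.
have sxx : (size (1 - x ^+ 2)%R <= 3)%N.
  rewrite (leq_trans (size_polyD _ _)) // geq_max size_poly1 size_polyN /=.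
  rewrite expr2 (leq_trans (size_polyMleq _ _)) //.
  by case: (size x) sx => [|[|[|s]]].
have mulb (p q : {poly R}) i j : (size p <= i.+1)%N -> (size q <= j)%N -> (size (p * q)%R <= i + j)%N.
  move=> sp sq; rewrite (leq_trans (size_polyMleq _ _)) //.
  have := leq_add sp sq; rewrite addSn.
  by case: (size p + size q)%N.
elim: m => [|m] /=; first by rewrite size_poly1 size_poly0.
case: (chebyshev x m) => t u /= [st su]; split.
  rewrite (leq_trans (size_polyD _ _)) // geq_max size_polyN.
  by rewrite (mulb _ _ 1%N) ?(mulb _ _ 2%N).
rewrite (leq_trans (size_polyD _ _)) // geq_max st andbT.
exact: (mulb _ _ 1%N).
Qed.

(** Closed forms in the Joukowski variable [r]. The second one stays a product because r^-1 - r
    vanishes at r = 1 and r = -1. *)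
Lemma chebyshev_joukowski (x : {poly R}) (s r : R) m :
  r != 0 -> x.[s] = (r + r^-1) / 2 ->
  (chebyshev x m).1.[s] = (r ^+ m + r^-1 ^+ m) / 2 /\
  (chebyshev x m).2.[s] * (r^-1 - r) = r^-1 ^+ m - r ^+ m.
Proof.
move=> r0 xs; elim: m => [|m] /=.
  by rewrite !hornerE !expr0; split; [field|ring].
case: (chebyshev x m) => t u /= [tE uE].
rewrite !hornerE xs tE !exprS.
have uE' : r^-1 ^+ m = u.[s] * (r^-1 - r) + r ^+ m by rewrite uE; ring.
by rewrite uE'; split; field.
Qed.

(** The witness is the Chebyshev polynomial composed with an affine map of [a, b] onto [-1, 1] and
    scaled to take the value 1 at 0. *)
Lemma chebyshev_residual (a b : R) m : 0 < a -> a <= b ->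
  let rho := (Num.sqrt (b / a) - 1) / (Num.sqrt (b / a) + 1) in
  exists p : {poly R}, [/\ (size p <= m.+1)%N, p.[0] = 1 &
    forall t, a <= t -> t <= b -> `|p.[t]| <= 2 * rho ^+ m].
Proof.
move=> a0 ab rho.
have b0 : 0 < b by apply: lt_le_trans ab.
have an0 : a != 0 by rewrite gt_eqF.
case: (ltrgtP a b) (ab) => // [ltab _|eab _]; last first.
  (* Here [rho] is 0 and the interval is the point [a], where (1 - t/a)^m vanishes unless m = 0, in
     which case the bound is 2. *)
  exists ((1 - a^-1 *: 'X) ^+ m); split.
  - rewrite (leq_trans (size_poly_exp_leq _ _)) // ltnS.
    have : (size (1 - a^-1 *: 'X : {poly R})%R <= 2)%N.
      rewrite (leq_trans (size_polyD _ _)) // geq_max size_poly1 size_polyN /=.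
      by rewrite (leq_trans (size_scale_leq _ _)) // size_polyX.
    by case: (size _) => [|[|[|s]]] //= _; rewrite ?mul0n ?mul1n.
  - by rewrite !hornerE subr0 expr1n.
  move=> t at_ tb; have -> : t = a by apply/eqP; rewrite eq_le at_ eab tb.
  rewrite /rho -eab divff // sqrtr1 subrr mul0r !hornerE mulVf // subrr.
  by case: m => [|m]; rewrite ?expr0n ?normr1 ?normr0 ?mulr0 ?mulr1 //= ?ler1n.
pose s := Num.sqrt (b / a).
have s2 : s ^+ 2 = b / a by rewrite sqr_sqrtr // divr_ge0 // ltW.
have bE : b = s ^+ 2 * a by rewrite s2 mulfVK.
have s1 : 1 < s.
  by rewrite -sqrtr1 ltr_sqrt ?divr_gt0 // ltr_pdivlMr // mul1r.
have rho0 : 0 < rho by rewrite divr_gt0 ?subr_gt0 // addr_gt0 // (lt_trans _ s1).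
have rn0 : rho != 0 by rewrite gt_eqF.
have bma : b - a != 0 by rewrite gt_eqF // subr_gt0.
(* It sends a to 1 and b to -1; its value at 0 is (b + a) / (b - a), whose Joukowski parameter is
   [rho]. *)
pose x : {poly R} := ((b + a) / (b - a))%:P - (2 / (b - a)) *: 'X.
have x0 : x.[0] = (rho + rho^-1) / 2.
  rewrite /x !hornerE ?mulr0 ?subr0 /rho -/s bE.
  field.
  have h1 : s + 1 != 0 by rewrite gt_eqF //; lra.
  have h2 : s - 1 != 0 by rewrite gt_eqF //; lra.
  rewrite h1 h2 /=.
  have -> : s ^+ 2 * a - a = (s + 1) * (s - 1) * a by ring.
  by rewrite !mulf_neq0.
have sx : (size x <= 2)%N.
  rewrite (leq_trans (size_polyD _ _)) // geq_max size_polyN.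
  rewrite (leq_trans (size_polyC_leq1 _)) //=.
  by rewrite (leq_trans (size_scale_leq _ _)) // size_polyX.
have [T0 _] := chebyshev_joukowski m rn0 x0.
have [sT _] := size_chebyshev m sx.
set T := (chebyshev x m).1 in T0 sT.
have T0gt : 0 < T.[0] by rewrite T0 divr_gt0 // addr_gt0 ?exprn_gt0 ?invr_gt0.
exists (T.[0]^-1 *: T); split.
- by rewrite (leq_trans (size_scale_leq _ _)).
- by rewrite hornerZ mulVf // gt_eqF.
move=> t at_ tb; rewrite hornerZ normrM gtr0_norm ?invr_gt0 //.
have Tt : `|T.[t]| <= 1.
  apply: chebyshev_le1.
  have -> : 1 = (1 : R) ^+ 2 by rewrite expr1n.
  rewrite -subr_ge0 subr_sqr.
  have xtE : x.[t] = (b + a) / (b - a) - 2 / (b - a) * t by rewrite /x !hornerE.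
  have -> : 1 - x.[t] = 2 * (t - a) / (b - a) by rewrite xtE; field.
  have -> : 1 + x.[t] = 2 * (b - t) / (b - a) by rewrite xtE; field.
  by rewrite !mulr_ge0 ?invr_ge0 ?subr_ge0 // ltW.
rewrite ler_pdivrMl // (le_trans Tt) // T0.
(* The claim 1 <= 2 rho^m T(0) just discards the term rho^(2m). *)
have -> : (rho ^+ m + rho^-1 ^+ m) / 2 * (2 * rho ^+ m) = 1 + rho ^+ m ^+ 2.
  rewrite exprVn; field; exact: expf_neq0.
by rewrite lerDl sqr_ge0.
Qed.

End Chebyshev.

(** * Euclidean inner product and norm *)

Section Dot.
Variable R : rcfType.

Definition dotv n (u v : 'cV[R]_n) : R := (u^T *m v) 0 0.

Lemma dotvE n (u v : 'cV[R]_n) : dotv u v = \sum_i u i 0 * v i 0.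
Proof. by rewrite /dotv mxE; apply: eq_bigr => i _; rewrite mxE. Qed.

Lemma dotvC n (u v : 'cV[R]_n) : dotv u v = dotv v u.
Proof. by rewrite !dotvE; apply: eq_bigr => i _; rewrite mulrC. Qed.

Lemma dotvDr n (u v w : 'cV[R]_n) : dotv u (v + w) = dotv u v + dotv u w.
Proof. by rewrite /dotv mulmxDr mxE. Qed.

Lemma dotvZr n a (u v : 'cV[R]_n) : dotv u (a *: v) = a * dotv u v.
Proof. by rewrite /dotv -scalemxAr mxE. Qed.

Lemma dotvNr n (u v : 'cV[R]_n) : dotv u (- v) = - dotv u v.
Proof. by rewrite /dotv mulmxN mxE. Qed.

Lemma dotvDl n (u v w : 'cV[R]_n) : dotv (v + w) u = dotv v u + dotv w u.
Proof. by rewrite ![dotv _ u]dotvC dotvDr. Qed.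

Lemma dotvZl n a (u v : 'cV[R]_n) : dotv (a *: u) v = a * dotv u v.
Proof. by rewrite ![dotv _ v]dotvC dotvZr. Qed.

Lemma dotvNl n (u v : 'cV[R]_n) : dotv (- u) v = - dotv u v.
Proof. by rewrite ![dotv _ v]dotvC dotvNr. Qed.

Lemma dotv_mulmxr m n (M : 'M[R]_(m, n)) u v : dotv u (M *m v) = dotv (M^T *m u) v.
Proof. by rewrite /dotv trmx_mul trmxK mulmxA. Qed.

Lemma dotvv_ge0 n (v : 'cV[R]_n) : 0 <= dotv v v.
Proof. by rewrite dotvE sumr_ge0 // => i _; rewrite -expr2 sqr_ge0. Qed.

Lemma dotvv_eq0 n (v : 'cV[R]_n) : (dotv v v == 0) = (v == 0).
Proof.
apply/eqP/eqP => [|->]; last by rewrite /dotv mulmx0 mxE.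
rewrite dotvE => /eqP; rewrite psumr_eq0; last by move=> i _; rewrite -expr2 sqr_ge0.
move=> /allP v0; apply/colP => i; rewrite mxE.
by have := v0 i (mem_index_enum i); rewrite /= mulf_eq0 orbb => /eqP.
Qed.

Lemma vnorm_ge0 n (v : 'cV[R]_n) : 0 <= vnorm v.
Proof. exact: sqrtr_ge0. Qed.

Lemma vnormE n (v : 'cV[R]_n) : vnorm v = Num.sqrt (dotv v v).
Proof. by rewrite /vnorm dotvE; congr Num.sqrt; apply: eq_bigr => i _; rewrite expr2. Qed.

Lemma sqr_vnorm n (v : 'cV[R]_n) : vnorm v ^+ 2 = dotv v v.
Proof. by rewrite vnormE sqr_sqrtr // dotvv_ge0. Qed.

Lemma vnorm_eq0 n (v : 'cV[R]_n) : (vnorm v == 0) = (v == 0).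
Proof. by rewrite -dotvv_eq0 -sqr_vnorm sqrf_eq0. Qed.

Lemma vnorm_gt0 n (v : 'cV[R]_n) : (0 < vnorm v) = (v != 0).
Proof. by rewrite lt0r vnorm_eq0 vnorm_ge0 andbT. Qed.

Lemma vnorm_le m n (u : 'cV[R]_m) (v : 'cV[R]_n) :
  dotv u u <= dotv v v -> vnorm u <= vnorm v.
Proof. by move=> uv; rewrite !vnormE ler_wsqrtr. Qed.

Lemma vnormZ n a (v : 'cV[R]_n) : vnorm (a *: v) = `|a| * vnorm v.
Proof.
rewrite !vnormE dotvZl dotvZr mulrA -expr2 sqrtrM ?sqr_ge0 //.
by rewrite sqrtr_sqr.
Qed.

Lemma vnormN n (v : 'cV[R]_n) : vnorm (- v) = vnorm v.
Proof. by rewrite -scaleN1r vnormZ normrN1 mul1r. Qed.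

Lemma dotv_le n (u v : 'cV[R]_n) : dotv u v <= vnorm u * vnorm v.
Proof.
have [->|u0] := eqVneq u 0; first by rewrite /dotv trmx0 mul0mx mxE mulr_ge0 ?vnorm_ge0.
have [->|v0] := eqVneq v 0; first by rewrite /dotv mulmx0 mxE mulr_ge0 ?vnorm_ge0.
have up : 0 < vnorm u by rewrite vnorm_gt0.
have vp : 0 < vnorm v by rewrite vnorm_gt0.
have := dotvv_ge0 (vnorm v *: u - vnorm u *: v).
rewrite !(dotvDl, dotvDr, dotvNl, dotvNr, dotvZl, dotvZr) -!sqr_vnorm (dotvC v u).
set a := vnorm u in up *; set b := vnorm v in vp *; set c := dotv u v => H.
have ab : 0 < 2 * (a * b) by rewrite mulr_gt0 ?mulr_gt0.
rewrite -subr_ge0 -(pmulr_rge0 _ ab); move: H; congr (0 <= _); ring.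
Qed.

Lemma normr_entry_le n (v : 'cV[R]_n) i : `|v i 0| <= vnorm v.
Proof.
rewrite -(@ler_pXn2r _ 2) ?nnegrE ?vnorm_ge0 // sqr_vnorm real_normK ?num_real //.
rewrite dotvE (bigD1 i) //= -expr2 lerDl sumr_ge0 // => j _.
by rewrite -expr2 sqr_ge0.
Qed.

Lemma vnorm_isometry m n (Q : 'M[R]_(m, n)) v : Q^T *m Q = 1%:M -> vnorm (Q *m v) = vnorm v.
Proof. by move=> QQ; rewrite !vnormE dotv_mulmxr mulmxA QQ mul1mx. Qed.

Lemma dotv_col_mx m n (u1 v1 : 'cV[R]_m) (u2 v2 : 'cV[R]_n) :
  dotv (col_mx u1 u2) (col_mx v1 v2) = dotv u1 v1 + dotv u2 v2.
Proof. by rewrite /dotv tr_col_mx mul_row_col mxE. Qed.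

(** * Positive definite matrices *)

Lemma psdE n (B : 'M[R]_n) : psd B -> forall v, 0 <= dotv v (B *m v).
Proof. by move=> Bp v; have := Bp v; rewrite /dotv mulmxA. Qed.

Definition posdef n (B : 'M[R]_n) := forall v : 'cV[R]_n, v != 0 -> 0 < dotv v (B *m v).

Lemma posdef_ge0 n (B : 'M[R]_n) v : posdef B -> 0 <= dotv v (B *m v).
Proof.
move=> Bp; have [->|v0] := eqVneq v 0; last exact/ltW/Bp.
by rewrite /dotv mulmx0 mulmx0 mxE.
Qed.

Lemma posdef_unit n (B : 'M[R]_n) : posdef B -> B \in unitmx.
Proof.
move=> Bp; rewrite -unitmx_tr -row_free_unit -kermx_eq0.
apply/eqP/row_matrixP => i; rewrite row0; set u := row i _.
have uB : u *m B^T = 0 by apply/sub_kermxP; rewrite row_sub.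
apply/eqP; rewrite -[u]trmxK trmx_eq0; apply/negPn/negP => /Bp.
rewrite dotvC /dotv trmx_mul !trmxK.
by rewrite uB mul0mx mxE ltxx.
Qed.

Lemma posdef_inv n (B : 'M[R]_n) : posdef B -> posdef (invmx B).
Proof.
move=> Bp v v0; have Bu := posdef_unit Bp.
rewrite -{1}[v](mulKVmx Bu) dotvC; apply: Bp.
by apply: contraNneq v0 => e; rewrite -[v](mulKVmx Bu) e mulmx0.
Qed.

(** * Polynomials of a symmetric matrix *)

Lemma tr_horner_mx n (A : 'M[R]_n.+1) p : (horner_mx A p)^T = horner_mx A^T p.
Proof.
elim/poly_ind: p => [|p c IH]; first by rewrite !rmorph0 trmx0.
rewrite !rmorphD !rmorphM /= !horner_mx_X !horner_mx_C raddfD /= tr_scalar_mx.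
congr (_ + _); rewrite [LHS]trmx_mul IH.
by apply: comm_mx_horner.
Qed.

Lemma rayleigh_bounds n (A : 'M[R]_n.+1) (a b : R) : symmetric_mx A ->
  (forall t, eigenvalue A t -> a <= t) -> (forall t, eigenvalue A t -> t <= b) ->
  forall v, a * dotv v v <= dotv v (A *m v) <= b * dotv v v.
Proof.
move=> Asym ha hb v.
have [d dA /(_ v)[w w0 pE]] := symmetric_spectral_measure Asym.
have -> : dotv v v = \sum_i w i.
  have := pE 1; rewrite rmorph1 mul1mx /dotv => ->.
  by apply: eq_bigr => i _; rewrite -polyC1 hornerC mul1r.
have := pE 'X; rewrite horner_mx_X /dotv => ->.
rewrite !mulr_sumr; apply/andP; split; apply: ler_sum => i _; rewrite hornerX ler_wpM2r //.
  exact: ha.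
exact: hb.
Qed.

(** By symmetry |p(A) v|^2 is the quadratic form of p^2, a sum of p(d)^2 against nonnegative weights
    of total mass |v|^2. *)
Lemma vnorm_horner_mx_le n (A : 'M[R]_n.+1) p (c : R) v : symmetric_mx A -> 0 <= c ->
  (forall t, eigenvalue A t -> `|p.[t]| <= c) ->
  vnorm (horner_mx A p *m v) <= c * vnorm v.
Proof.
move=> Asym c0 hp.
have [d dA /(_ v)[w w0 pE]] := symmetric_spectral_measure Asym.
rewrite -(@ler_pXn2r _ 2) ?nnegrE ?mulr_ge0 ?vnorm_ge0 //.
rewrite exprMn !sqr_vnorm [dotv (_ *m v) _]dotv_mulmxr tr_horner_mx Asym [dotv _ v]dotvC.
rewrite [X in dotv v X]mulmxA -[_ *m horner_mx A p]rmorphM /dotv pE.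
have := pE 1; rewrite rmorph1 mul1mx => ->.
rewrite mulr_sumr; apply: ler_sum => i _.
rewrite -polyC1 hornerC mul1r hornerM ler_wpM2r // -expr2.
rewrite -[p.[_] ^+ 2]real_normK ?num_real //.
by rewrite ler_pXn2r ?nnegrE //; apply: hp.
Qed.

(* [1 + 'X * s] is the product of the [1 - 'X / d] over the eigenvalues [d]. *)
Lemma inverse_polynomial n (T : 'M[R]_n.+1) : symmetric_mx T ->
  (forall t, eigenvalue T t -> 0 < t) ->
  exists s : {poly R}, [/\ (size s <= n.+1)%N, s.[0] <= 0 &
    T *m horner_mx T s = - 1%:M].
Proof.
move=> Tsym Tpos; have [d dT pE] := symmetric_spectral_measure Tsym.
have [s [ss s0 sE]] : exists s : {poly R}, [/\ (size s <= n.+1)%N, s.[0] <= 0 &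
    forall i, (1 + 'X * s).[d i] = 0].
  have H (l : seq 'I_n.+1) : exists s : {poly R}, [/\ (size s <= size l)%N, s.[0] <= 0 &
      {in l, forall i, (1 + 'X * s).[d i] = 0}].
    elim: l => [|i l [s [ss s0 sE]]]; first by exists 0; rewrite size_poly0 horner0.
    have di : 0 < d i by apply: Tpos.
    (* For this s', 1 + X s' = (1 - X / d_i) (1 + X s): it gains the zero d_i, and s'(0) = s(0) - 1
       / d_i. *)
    exists (s - (d i)^-1 *: (1 + 'X * s)); split.
    - rewrite (leq_trans (size_polyD _ _)) // geq_max (leq_trans ss) //= size_polyN.
      rewrite (leq_trans (size_scale_leq _ _)) // (leq_trans (size_polyD _ _)) //.
      rewrite geq_max size_poly1 /= (leq_trans (size_polyMleq _ _)) // size_polyX.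
      by rewrite /= ltnS.
    - by rewrite !hornerE; rewrite subr_le0 (le_trans s0) // invr_ge0 ltW.
    move=> j; have -> : 1 + 'X * (s - (d i)^-1 *: (1 + 'X * s)) =
        (1 - (d i)^-1 *: 'X) * (1 + 'X * s).
      by rewrite -!mul_polyC; ring.
    rewrite inE hornerM => /orP[/eqP->|/sE->]; last by rewrite mulr0.
    by rewrite !hornerE mulVf ?gt_eqF // subrr mul0r.
  have [s [ss s0 sE]] := H (enum 'I_n.+1); exists s; split=> //.
    by rewrite (leq_trans ss) // size_enum_ord.
  by move=> i; rewrite sE ?mem_enum.
exists s; split=> //; apply/eqP; rewrite -addr_eq0 addrC; apply/eqP.
have -> : 1%:M + T *m horner_mx T s = horner_mx T (1 + 'X * s).
  by rewrite rmorphD rmorphM /= horner_mx_X [horner_mx T 1]rmorph1.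
apply/matrixP => i j; rewrite [RHS]mxE.
have -> : horner_mx T (1 + 'X * s) i j = (horner_mx T (1 + 'X * s) *m delta_mx j 0 : 'cV_n.+1) i 0.
  by rewrite -colE mxE.
set v := delta_mx j 0; suff -> : horner_mx T (1 + 'X * s) *m v = 0 by rewrite mxE.
(* With q = 1 + X s, |q(T) v|^2 is a weighted sum of the q(d)^2, all zero; basis vectors [v] reach
   every column. *)
apply/eqP; rewrite -dotvv_eq0 dotv_mulmxr tr_horner_mx Tsym dotvC.
rewrite [X in dotv v X]mulmxA -[_ *m horner_mx T _]rmorphM /dotv.
have [w _ ->] := pE v; rewrite big1 // => l _.
by rewrite hornerM sE !mul0r.
Qed.

End Dot.

(** * Compression to a Krylov space and Galerkin solutions *)

Section Galerkin.
Variable R : rcfType.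

Lemma symmetric_shift n (A : 'M[R]_n) c : symmetric_mx A -> symmetric_mx (A + c%:M).
Proof. by rewrite /symmetric_mx raddfD /= tr_scalar_mx => ->. Qed.

Lemma symmetric_compress m n (B : 'M[R]_m) (Q : 'M[R]_(m, n)) :
  symmetric_mx B -> symmetric_mx (Q^T *m B *m Q).
Proof. by rewrite /symmetric_mx => Bs; rewrite !trmx_mul trmxK Bs mulmxA. Qed.

Lemma symmetric_eigenvector n (A : 'M[R]_n) t : symmetric_mx A -> eigenvalue A t ->
  exists2 u : 'cV_n, u != 0 & A *m u = t *: u.
Proof.
move=> As /eigenvalueP[v vA v0]; exists v^T; first by rewrite trmx_eq0.
by rewrite -As -trmx_mul vA linearZ.
Qed.

Lemma posdef_eigenvalue_gt0 n (A : 'M[R]_n) t : symmetric_mx A -> posdef A ->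
  eigenvalue A t -> 0 < t.
Proof.
move=> As Ap /(symmetric_eigenvector As)[u u0 Au]; have := Ap u u0.
by rewrite Au dotvZr pmulr_lgt0 // lt0r dotvv_eq0 u0 dotvv_ge0.
Qed.

(** An eigenvector [u] of the compression lifts to [Q *m u], whose Rayleigh quotient for [A] is the
    same number. *)
Lemma compress_eigenvalue_bounds n m (A : 'M[R]_n.+1) (Q : 'M[R]_(n.+1, m)) (a b : R) :
  symmetric_mx A -> Q^T *m Q = 1%:M ->
  (forall t, eigenvalue A t -> a <= t) -> (forall t, eigenvalue A t -> t <= b) ->
  forall t, eigenvalue (Q^T *m A *m Q) t -> a <= t <= b.
Proof.
move=> As QQ ha hb t /(symmetric_eigenvector (symmetric_compress Q As))[u u0 Tu].
have := rayleigh_bounds As ha hb (Q *m u).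
have -> : dotv (Q *m u) (A *m (Q *m u)) = t * dotv u u.
  by rewrite dotvC dotv_mulmxr !mulmxA Tu dotvZl.
have uu : 0 < vnorm u ^+ 2 by rewrite exprn_gt0 // vnorm_gt0.
by rewrite -!sqr_vnorm vnorm_isometry // !(ler_pM2r uu).
Qed.

Lemma posdef_compress m n (B : 'M[R]_m) (Q : 'M[R]_(m, n)) :
  posdef B -> Q^T *m Q = 1%:M -> posdef (Q^T *m B *m Q).
Proof.
move=> Bp QQ v v0; rewrite -!mulmxA dotv_mulmxr trmxK; apply: Bp.
by rewrite -vnorm_eq0 vnorm_isometry // vnorm_eq0.
Qed.

Lemma horner_mx_shift n (A : 'M[R]_n.+1) c p :
  horner_mx (A + c%:M) p = horner_mx A (p \Po ('X + c%:P)).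
Proof.
elim/poly_ind: p => [|p a IH]; first by rewrite comp_poly0 !rmorph0.
rewrite comp_poly_MXaddC !rmorphD !rmorphM rmorphD /= !horner_mx_X !horner_mx_C.
by rewrite IH.
Qed.

Lemma horner_mx_krylov n (A : 'M[R]_n.+1) (g : 'cV_n.+1) j (p : {poly R}) : (size p <= j)%N ->
  ((horner_mx A p *m g)^T <= krylov A g j)%MS.
Proof.
move=> sp; rewrite -[p]coefK poly_def linear_sum /= mulmx_suml linear_sum /=.
apply: summx_sub => i _; rewrite linearZ /= -scalemxAl linearZ /= scalemx_sub //.
rewrite rmorphXn /= horner_mx_X.
have ij : (i < j)%N by apply: leq_trans sp.
have -> : (A ^+ i *m g)^T = row (Ordinal ij) (krylov A g j).
  by apply/rowP => l; rewrite !mxE.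
exact: row_sub.
Qed.

(** Substituting X + c keeps the degree, so the Krylov spaces of [A] also serve the shifted
    matrix. *)
Lemma horner_mx_shift_krylov n (A : 'M[R]_n.+1) (g : 'cV_n.+1) c j (p : {poly R}) : (size p <= j)%N ->
  ((horner_mx (A + c%:M) p *m g)^T <= krylov A g j)%MS.
Proof.
by move=> sp; rewrite horner_mx_shift horner_mx_krylov // size_comp_poly2 // size_XaddC.
Qed.

Lemma orthoproj_id m n (Q : 'M[R]_(m, n)) (v : 'cV_m) : Q^T *m Q = 1%:M ->
  (v^T <= Q^T)%MS -> Q *m (Q^T *m v) = v.
Proof.
move=> QQ /submxP[D vD]; have -> : v = Q *m D^T by rewrite -[v]trmxK vD trmx_mul trmxK.
by rewrite [Q^T *m _]mulmxA QQ mul1mx.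
Qed.

(** Every partial Horner value lies in the range of [Q], where [Q *m Q^T] is the identity, so
    compressing at each step loses nothing. *)
Lemma compress_horner n k (B : 'M[R]_n.+1) (Q : 'M[R]_(n.+1, k.+1)) (g : 'cV_n.+1) :
  Q^T *m Q = 1%:M ->
  (forall p : {poly R}, (size p <= k.+1)%N -> ((horner_mx B p *m g)^T <= Q^T)%MS) ->
  forall p : {poly R}, (size p <= k.+1)%N ->
    Q *m (horner_mx (Q^T *m B *m Q) p *m (Q^T *m g)) = horner_mx B p *m g.
Proof.
move=> QQ Kp; elim/poly_ind => [|p c IH] sp; first by rewrite !rmorph0 !mul0mx mulmx0.
have {}IH : Q *m (horner_mx (Q^T *m B *m Q) p *m (Q^T *m g)) = horner_mx B p *m g.
  apply: IH; apply: leq_trans sp; rewrite size_MXaddC.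
  by case: eqP => [->|] //=; rewrite size_poly0.
rewrite -[RHS](orthoproj_id QQ (Kp _ sp)); congr (_ *m _).
rewrite !(mulrC p) !rmorphD !rmorphM /= !horner_mx_X !horner_mx_C.
rewrite !mulmxDl !mulmxDr !mul_scalar_mx -scalemxAr; congr (_ + _).
by rewrite -[_ * horner_mx B p *m g]mulmxA -IH -[LHS]mulmxA !mulmxA.
Qed.

(* With [h = s(T) Q^T g] and [e = x - Q h], Galerkin orthogonality turns
   [<Q h, e>] into [- s(0) <e, B e>], and [s(0) = - tr T^-1 <= 0]. *)
Lemma galerkin_norm_le n k (B : 'M[R]_n.+1) (Q : 'M[R]_(n.+1, k.+1)) (g x : 'cV_n.+1) h :
  symmetric_mx B -> posdef B -> Q^T *m Q = 1%:M ->
  (forall p : {poly R}, (size p <= k.+1)%N -> ((horner_mx B p *m g)^T <= Q^T)%MS) ->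
  B *m x = - g -> Q^T *m B *m Q *m h = - (Q^T *m g) ->
  vnorm h <= vnorm x.
Proof.
move=> Bs Bp QQ Kp Bx Th; set T := Q^T *m B *m Q in Th.
have Ts : symmetric_mx T by exact: symmetric_compress.
have Tp : posdef T by exact: posdef_compress.
have [s [ss s0 Ts1]] := inverse_polynomial Ts (fun t => posdef_eigenvalue_gt0 Ts Tp).
have hE : h = horner_mx T s *m (Q^T *m g).
  have Tu := posdef_unit Tp; rewrite -[h](mulKmx Tu) -[RHS](mulKmx Tu) Th.
  by rewrite [T *m (_ *m _)]mulmxA Ts1 mulNmx mul1mx.
have QhE : Q *m h = horner_mx B s *m g by rewrite hE compress_horner.
pose e := x - Q *m h; pose r := B *m (Q *m h) + g.
have Be : B *m e = - r by rewrite mulmxBr Bx /r opprD addrC.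
have Qr : Q^T *m r = 0 by rewrite mulmxDr !mulmxA -/T Th addrC subrr.
have orth w : dotv (Q *m w) r = 0 by rewrite dotvC dotv_mulmxr Qr /dotv trmx0 mul0mx mxE.
have BE u v : dotv u (B *m v) = dotv (B *m u) v by rewrite dotv_mulmxr Bs.
(* As g = - B x, the left side is - <x, B e>, and the part [Q *m h] of x is orthogonal to B e = -
   r. *)
have ge : dotv g e = - dotv e (B *m e).
  rewrite -[g]opprK -Bx dotvNl -BE; congr (- _).
  by rewrite -{1}[x](subrK (Q *m h)) -/e dotvDl [in X in _ + X]Be dotvNr orth oppr0 addr0.
(* The constant term of s contributes s(0) <g, e>; the rest of s(B) g is B applied to a vector in
   the range of [Q], hence orthogonal to e. *)
have Qhe : dotv (Q *m h) e = - s.[0] * dotv e (B *m e).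
  have sE : s = s.[0]%:P + 'X * drop_poly 1 s.
    by apply/polyP => i; rewrite coefD coefC coefXM coef_drop_poly horner_coef0;
      case: i => [|i]; rewrite /= ?addr0 ?add0r ?addn1.
  rewrite QhE {1}sE rmorphD rmorphM /= horner_mx_X horner_mx_C mulmxDl mul_scalar_mx.
  rewrite dotvDl dotvZl ge -[_ * _ *m g]mulmxA -BE Be -(compress_horner QQ Kp).
    by rewrite !dotvNr orth oppr0 addr0 mulrN mulNr.
  by rewrite size_drop_poly (leq_trans (leq_subr _ _)).
apply: vnorm_le; rewrite -!sqr_vnorm -(vnorm_isometry h QQ) !sqr_vnorm.
have xE : x = Q *m h + e by rewrite addrC subrK.
clearbody e; rewrite {}xE.
rewrite !(dotvDl, dotvDr) [dotv e (Q *m h)]dotvC Qhe.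
have := posdef_ge0 e Bp; have := dotvv_ge0 e; rewrite -oppr_ge0 in s0.
move=> ee eBe; have := mulr_ge0 s0 eBe; lra.
Qed.

(* [h] differs from [p(T) h] by an element of the Krylov space of [T] of
   dimension [k], whose last coordinate vanishes. *)
Lemma galerkin_last_entry_le k (T : 'M[R]_k.+1) (f h : 'cV_k.+1) (a b : R) :
  symmetric_mx T -> 0 < a -> a <= b ->
  (forall t, eigenvalue T t -> a <= t <= b) ->
  (forall p : {poly R}, (size p <= k)%N -> (horner_mx T p *m f) ord_max 0 = 0) ->
  T *m h = - f ->
  `|h ord_max 0| <=
    2 * ((Num.sqrt (b / a) - 1) / (Num.sqrt (b / a) + 1)) ^+ k * vnorm h.
Proof.
move=> Ts a0 ab hT hf Th.
have [p [sp p0 pb]] := chebyshev_residual k a0 ab.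
(* Uses p(0) = 1. As T h = - f, this gives p(T) h = h - p1(T) f with p1 of size at most k. *)
have pE : p = 1 + drop_poly 1 p * 'X.
  by apply/polyP => i; rewrite coefD coef1 coefMX coef_drop_poly;
    case: i => [|i]; rewrite /= ?addr0 ?add0r ?addn1 // -horner_coef0.
have -> : h ord_max 0 = (horner_mx T p *m h) ord_max 0.
  rewrite {1}pE rmorphD rmorph1 rmorphM /= horner_mx_X mulmxDl mul1mx mxE.
  rewrite -[_ * T *m h]mulmxA Th mulmxN [X in _ + X]mxE hf ?oppr0 ?addr0 //.
  by rewrite size_drop_poly leq_subLR add1n.
apply: le_trans (normr_entry_le _ _) _; apply: vnorm_horner_mx_le => //.
  have s1 : 1 <= Num.sqrt (b / a).
    by rewrite -sqrtr1 ler_wsqrtr // ler_pdivlMr // mul1r.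
  by rewrite mulr_ge0 // exprn_ge0 // divr_ge0 ?subr_ge0 // addr_ge0 ?sqrtr_ge0.
by move=> t /hT/andP[]; apply: pb.
Qed.

End Galerkin.

(** * Multiplier gap and norm gap *)

Section TrustRegion.
Variable R : rcfType.

Lemma symmetric_inv n (T : 'M[R]_n) : symmetric_mx T -> symmetric_mx (invmx T).
Proof. by rewrite /symmetric_mx trmx_inv => ->. Qed.

Lemma eigenvalue_shift n (A : 'M[R]_n) c t :
  eigenvalue (A + c%:M) t -> eigenvalue A (t - c).
Proof.
move=> /eigenvalueP[v vA v0]; apply/eigenvalueP; exists v => //.
by rewrite scalerBl -vA mulmxDr mul_mx_scalar addrK.
Qed.

(* Convexity of the secular function [mu |-> |(T + mu I)^-1 f|^2], stated for
   the solutions themselves because [T - delta I] may be singular. *)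
Lemma secular_convexity k (T : 'M[R]_k) (h ht : 'cV_k) (delta : R) :
  symmetric_mx T -> posdef T -> psd (T - delta%:M) -> 0 <= delta ->
  T *m ht = (T - delta%:M) *m h ->
  2 * delta * dotv ht (invmx T *m ht) <= dotv h h - dotv ht ht.
Proof.
move=> Ts Tp Sp d0 E; have Tu := posdef_unit Tp.
pose u := invmx T *m h; pose w := invmx T *m u.
have Tu_h : T *m u = h by rewrite mulKVmx.
have Tw_u : T *m w = u by rewrite mulKVmx.
have htE : ht = h - delta *: u.
  by rewrite -[LHS](mulKmx Tu) E mulmxBl mul_scalar_mx mulmxBr mulKmx // -scalemxAr.
have -> : invmx T *m ht = u - delta *: w by rewrite htE mulmxBr -scalemxAr.
have hw : dotv h w = dotv u u by rewrite -{1}Tu_h dotvC dotv_mulmxr Ts Tw_u.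
have Sw : (T - delta%:M) *m w = u - delta *: w by rewrite mulmxBl mul_scalar_mx Tw_u.
have := psdE Sp w; have := dotvv_ge0 u; have := dotvv_ge0 ((T - delta%:M) *m w).
rewrite Sw htE !(dotvDl, dotvDr, dotvNl, dotvNr, dotvZl, dotvZr) hw.
rewrite (dotvC w u) (dotvC u h); set uu := dotv u u; set uw := dotv u w.
set ww := dotv w w => p1 p2 p3.
(* With S = T - delta I, the difference of the two sides is exactly 2 delta^2 |S w|^2 + delta^2
   |u|^2 + 2 delta^3 <w, S w>. *)
have q1 := mulr_ge0 (sqr_ge0 delta) p1; have q2 := mulr_ge0 (sqr_ge0 delta) p2.
have q3 := mulr_ge0 (exprn_ge0 3 d0) p3.
rewrite -subr_ge0.
apply: le_trans (addr_ge0 (addr_ge0 (addr_ge0 q1 q1) q2) (addr_ge0 q3 q3)) _.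
by rewrite le_eqVlt; apply/orP; left; apply/eqP; ring.
Qed.

(** The gap is 2 <x - xt, x> - |x - xt|^2 with xt = Q h. Writing x = B v moves B onto the error and
    yields the residual, which only sees the part of v orthogonal to the range of [Q]. *)
Lemma galerkin_norm_gap n k (B : 'M[R]_n) (Q : 'M[R]_(n, k)) (g x v : 'cV_n) h :
  symmetric_mx B -> B *m x = - g -> B *m v = x ->
  Q^T *m (B *m (Q *m h) + g) = 0 ->
  dotv x x - dotv (Q *m h) (Q *m h) <=
    2 * (vnorm (B *m (Q *m h) + g) * vnorm ((1%:M - Q *m Q^T) *m v)).
Proof.
move=> Bs Bx Bv; set xt := Q *m h; set r := B *m xt + g => Qr.
have Bd : B *m (x - xt) = - r by rewrite mulmxBr Bx /r opprD addrC.
have dx : dotv (x - xt) x = dotv (- r) ((1%:M - Q *m Q^T) *m v).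
  rewrite -{2}Bv dotv_mulmxr Bs Bd mulmxBl mul1mx [in RHS]dotvDr [dotv _ (- _)]dotvNr.
  rewrite -mulmxA [dotv _ (Q *m _)]dotv_mulmxr mulmxN Qr oppr0.
  by rewrite [X in _ - X]/dotv trmx0 mul0mx mxE subr0.
have := dotv_le (- r) ((1%:M - Q *m Q^T) *m v).
rewrite -dx vnormN => le1.
have := dotvv_ge0 (x - xt).
rewrite !(dotvDl, dotvDr, dotvNl, dotvNr, dotvZl, dotvZr) in le1 *.
rewrite (dotvC xt x) in le1 *; lra.
Qed.

(** * Consequences of the Lanczos process *)

Lemma Qk_gramE n (q : nat -> 'cV[R]_n) k (i j : 'I_k) :
  ((Qk q k)^T *m Qk q k) i j = dotv (q i) (q j).
Proof. by rewrite mxE dotvE; apply: eq_bigr => l _; rewrite !mxE. Qed.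

Lemma Qk_orthonormal n (q : nat -> 'cV[R]_n) k kmax : (k <= kmax)%N ->
  (Qk q kmax)^T *m Qk q kmax = 1%:M -> (Qk q k)^T *m Qk q k = 1%:M.
Proof.
move=> kk QQ; apply/matrixP => i j; rewrite Qk_gramE.
have := Qk_gramE q (widen_ord kk i) (widen_ord kk j).
by rewrite QQ !mxE => /esym.
Qed.

Lemma krylov_step n (A : 'M[R]_n.+1) (g v : 'cV_n.+1) j : symmetric_mx A ->
  (v^T <= krylov A g j)%MS -> ((A *m v)^T <= krylov A g j.+1)%MS.
Proof.
move=> As vK; rewrite trmx_mul As; apply: submx_trans (submxMr A vK) _.
apply/row_subP => i; rewrite row_mul.
have -> : row i (krylov A g j) *m A = row (lift ord0 i) (krylov A g j.+1); last exact: row_sub.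
have -> : row i (krylov A g j) = (A ^+ i *m g)^T by apply/rowP => l; rewrite !mxE.
rewrite -[X in _ *m X]As -trmx_mul mulmxA; apply/rowP => l.
by rewrite !mxE lift0 exprS.
Qed.

Lemma krylov_widen n (A : 'M[R]_n) (g : 'cV_n) j k : (j <= k)%N ->
  (krylov A g j <= krylov A g k)%MS.
Proof.
move=> jk; apply/row_subP => i.
have -> : row i (krylov A g j) = row (widen_ord jk i) (krylov A g k).
  by apply/rowP => l; rewrite !mxE.
exact: row_sub.
Qed.

(** The defect is A Q projected off the range of [Q]. Only its last column can survive, because A
    maps the earlier basis vectors into that range. *)
Lemma lanczos_recurrence n (A : 'M[R]_n.+1) (g : 'cV_n.+1) q kmax k (h : 'cV_k.+1) :
  symmetric_mx A -> lanczos A g q kmax -> (k < kmax)%N ->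
  (A *m Qk q k.+1 - Qk q k.+1 *m Tk A q k.+1) *m h =
  h ord_max 0 *: ((A *m Qk q k.+1 - Qk q k.+1 *m Tk A q k.+1) *m e_last R k.+1).
Proof.
move=> As [_ _ [QQ QK _ _]] kk; set Q := Qk q k.+1; set N := A *m Q - _.
have QQk : Q^T *m Q = 1%:M by apply: Qk_orthonormal QQ.
have Ncol j : (j < k)%N -> forall jk : (j < k.+1)%N, col (Ordinal jk) N = 0.
  move=> ltjk jk.
  have -> : N = A *m Q - Q *m (Q^T *m (A *m Q)) by rewrite /N /Tk !mulmxA.
  rewrite colE mulmxBl -!mulmxA -!colE.
  have -> : col (Ordinal jk) Q = q j by apply/colP => l; rewrite !mxE.
  rewrite orthoproj_id ?subrr //.
  have /andP[_ K2] := QK k.+1 kk; apply: submx_trans K2.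
  (* [q j] is 0-indexed, so it lies in K_(j+1); its image lies in K_(j+2), and j + 2 <= k + 1. *)
  apply: (@submx_trans _ _ _ _ _ _ (krylov A g j.+2)); last exact: krylov_widen.
  apply: krylov_step => //.
  have /andP[K1 _] := QK j.+1 (leq_trans jk kk); apply: submx_trans K1.
  have -> : (q j)^T = row ord_max (Qk q j.+1)^T by apply/rowP => l; rewrite !mxE.
  exact: row_sub.
have {}Ncol j i : (j : 'I_k.+1) != ord_max -> N i j = 0.
  move=> jm; have ltjk : (j < k)%N.
    by rewrite ltn_neqAle -ltnS ltn_ord andbT; apply: contraNneq jm => e; apply/eqP/val_inj.
  have /colP/(_ i) := Ncol j ltjk (ltn_ord j); rewrite [LHS]mxE [RHS]mxE => <-.
  by congr (N i _); apply: val_inj.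
clearbody N; apply/colP => i; rewrite !mxE.
have sumE (u : 'cV_k.+1) : \sum_j N i j * u j 0 = N i ord_max * u ord_max 0.
  by rewrite (bigD1 ord_max) //= big1 ?addr0 // => j jm; rewrite Ncol // mul0r.
by rewrite !sumE mxE eqxx mulr1 mulrC.
Qed.

(** The last coordinate is the inner product of Q w with [q k], which is orthogonal to the earlier
    basis vectors, and these span K_k. *)
Lemma lanczos_last_entry0 n (A : 'M[R]_n.+1) (g : 'cV_n.+1) q kmax k (w : 'cV_k.+1) :
  lanczos A g q kmax -> (k < kmax)%N ->
  ((Qk q k.+1 *m w)^T <= krylov A g k)%MS -> w ord_max 0 = 0.
Proof.
move=> [_ _ [QQ QK _ _]] kk wK.
have QQk : (Qk q k.+1)^T *m Qk q k.+1 = 1%:M by apply: Qk_orthonormal QQ.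
have /andP[_ K2] := QK k (ltnW kk); have /submxP[C CE] := submx_trans wK K2.
have -> : w = (Qk q k.+1)^T *m (Qk q k *m C^T).
  by rewrite -[w in LHS]mul1mx -QQk -mulmxA -[Qk q k.+1 *m w in LHS]trmxK CE trmx_mul trmxK.
rewrite mulmxA mxE big1 // => j _.
have -> : ((Qk q k.+1)^T *m Qk q k) ord_max j = 0; last by rewrite mul0r.
have := Qk_gramE q ord_max (widen_ord (leqnSn k) j); rewrite QQk !mxE /=.
rewrite -val_eqE /= gtn_eqF // dotvE => E; apply: etrans (esym E).
by apply: eq_bigr => l _; rewrite !mxE.
Qed.

(** * Angles and the eigenvector of the block matrix *)

Lemma sin_angleZ m p (W : 'M[R]_(m, p)) c v : c != 0 -> sin_angle W (c *: v) = sin_angle W v.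
Proof.
move=> c0; rewrite /sin_angle -scalemxAr !vnormZ -mulf_div divff ?mul1r //.
by rewrite normr_eq0.
Qed.

Lemma sin_angle_ge0 m p (W : 'M[R]_(m, p)) v : 0 <= sin_angle W v.
Proof. by rewrite divr_ge0 ?vnorm_ge0. Qed.

(** The projection off the range of [Qk2] acts on the two halves separately, so the residual of [y]
    dominates that of its lower half. *)
Lemma sin_angle_Qk2 n (q : nat -> 'cV[R]_n) k (y : 'cV_(n + n)) : vnorm y = 1 ->
  sin_angle (Qk q k) (dsubmx y) * vnorm (dsubmx y) <= sin_angle (Qk2 q k) y.
Proof.
move=> y1; rewrite /sin_angle y1 divr1.
have [y20|y20] := eqVneq (vnorm (dsubmx y)) 0; first by rewrite y20 mulr0 vnorm_ge0.
rewrite mulfVK //; apply: vnorm_le.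
rewrite -{3 4}[y]vsubmxK !mulmxBl !mul1mx /Qk2 tr_block_mx !trmx0 mulmx_block.
rewrite !mul0mx !mulmx0 !addr0 !add0r mul_block_col !mul0mx !addr0 !add0r.
by rewrite opp_col_mx add_col_mx dotv_col_mx lerDr dotvv_ge0.
Qed.

(* [y1 = B y2], and [B y1] is a multiple of [g = - B x]. *)
Lemma Mmat_eigenvector n (A : 'M[R]_n) (g x v : 'cV_n) (D lam : R) y :
  A + lam%:M \in unitmx -> (A + lam%:M) *m x = - g -> (A + lam%:M) *m v = x ->
  Mmat A g D *m y = lam *: y -> y != 0 ->
  exists2 c, c != 0 & dsubmx y = c *: v.
Proof.
move=> Bu Bx Bv My y0; set B := A + lam%:M in Bu Bx Bv.
have [E1 E2] : - A *m usubmx y + (D ^+ 2)^-1 *: (g *m g^T) *m dsubmx y = lam *: usubmx y /\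
    usubmx y - A *m dsubmx y = lam *: dsubmx y.
  move: My; rewrite -{1 2}[y]vsubmxK mul_block_col scale_col_mx mul1mx mulNmx.
  by move=> /eq_col_mx[]; rewrite mulNmx.
have y1E : usubmx y = B *m dsubmx y.
  by rewrite mulmxDl mul_scalar_mx -E2 addrC subrK.
(* The upper block row reads B y1 = D^-2 <g, y2> g; the sign turns this into c B x. *)
pose c := - ((D ^+ 2)^-1 * dotv g (dsubmx y)).
have By1 : B *m usubmx y = c *: (- g).
  rewrite mulmxDl mul_scalar_mx -E1 mulNmx addrA subrr add0r -scalemxAl -mulmxA.
  by rewrite [g^T *m _]mx11_scalar mul_mx_scalar scalerA scalerN /c scaleNr opprK.
have y1x : usubmx y = c *: x by rewrite -[LHS](mulKmx Bu) By1 -Bx -scalemxAr mulKmx.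
have y2v : dsubmx y = c *: v.
  by rewrite -[LHS](mulKmx Bu) -y1E y1x -Bv -scalemxAr mulKmx.
(* If c = 0, both halves c x and c v of [y] vanish. *)
exists c => //; apply: contraNneq y0 => c0.
by rewrite -[y]vsubmxK y1x y2v c0 !scale0r col_mx0.
Qed.

End TrustRegion.

(** * Assembly of the two inequalities *)

Theorem theorem5p3 (R : rcfType) (n : nat) (A : 'M[R]_n) (g : 'cV[R]_n)
    (D : R) (alpha1 alphan : R)
    (xopt : 'cV[R]_n) (lamopt : R)
    (q : nat -> 'cV[R]_n) (kmax k : nat)
    (hk : 'cV[R]_k) (lamk : R) (y : 'cV[R]_(n + n)) :
  symmetric_mx A -> g != 0 -> 0 < D ->
  (* alpha1 = largest, alphan = smallest eigenvalue of A *)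
  eigenvalue A alpha1 -> (forall a, eigenvalue A a -> a <= alpha1) ->
  eigenvalue A alphan -> (forall a, eigenvalue A a -> alphan <= a) ->
  trs_solution A g D xopt lamopt ->
  lamopt > - alphan ->                              (* easy case *)
  lanczos A g q kmax ->
  (1 <= k <= kmax)%N ->
  (* GLTR iterate h_k with multiplier lambda_k *)
  trs_solution (Tk A q k) (vnorm g *: e_first R k) D hk lamk ->
  vnorm xopt = D -> vnorm (Qk q k *m hk) = D ->
  (* y unit eigenvector of M for lamopt *)
  Mmat A g D *m y = lamopt *: y -> vnorm y = 1 ->
  let kappa := (alpha1 + lamopt) / (alphan + lamopt) in
  let Aopt := A + lamopt%:M in
  let Bk := invmx (Tk A q k + lamopt%:M) in
  let htil := - (vnorm g *: (Bk *m e_first R k)) in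
  let xtil := Qk q k *m htil in
  let rtil := Aopt *m xtil + g in
  let sk := vnorm (invmx Aopt *m xopt) /
            (vnorm g * ((e_first R k)^T *m (Bk *m Bk *m Bk) *m e_first R k) 0 0) in
  let y1 := usubmx y in
  let y2 := dsubmx y in
  let rho := (Num.sqrt kappa - 1) / (Num.sqrt kappa + 1) in
  lamopt - lamk <= sk * (vnorm rtil / vnorm g) * sin_angle (Qk q k) y2 /\
  sk * (vnorm rtil / vnorm g) * sin_angle (Qk q k) y2 <=
    sk * (2 * betak A q k * D / (vnorm y2 * vnorm g)) * rho ^+ k.-1
       * sin_angle (Qk2 q k) y.
Proof.
(* Matrix polynomials need successor dimensions. From here on [k.+1] replaces the [k] of the
   statement, so the exponent k - 1 becomes [k]. *)
case: n A g xopt q y => [|n] A g xopt q y; first by move=> _ /eqP[]; apply: flatmx0.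
case: k hk => [|k] hk; first by move=> *.
move=> As g0 D0 _ hb _ ha [_ _ _ [Bx _ _]] easy lan kk [_ _ _ [Tkh _ Spsd]] xD hD My y1.
set Q := Qk q k.+1 in hD *; set T := Tk A q k.+1 + lamopt%:M.
move=> kappa Aopt Bk htil xtil rtil sk y1' y2 rho; rewrite -/Aopt in Bx.
have {}kk : (k < kmax)%N by case/andP: kk.
have [_ q0E [QQm QK _ _]] := lan.
have QQ : Q^T *m Q = 1%:M by apply: Qk_orthonormal QQm.
pose a := alphan + lamopt; pose b := alpha1 + lamopt.
(* The easy case makes [a], the lower spectral bound of [Aopt], positive. *)
have a0 : 0 < a by rewrite /a; lra.
have Bs : symmetric_mx Aopt by exact: symmetric_shift.
have Bp : posdef Aopt.
  move=> v v0; have /andP[le1 _] := rayleigh_bounds As ha hb v.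
  rewrite mulmxDl mul_scalar_mx dotvDr dotvZr.
  apply: lt_le_trans (_ : a * dotv v v <= _); last by rewrite mulrDl lerD2r.
  by rewrite mulr_gt0 // lt0r dotvv_eq0 v0 dotvv_ge0.
have Bu := posdef_unit Bp.
have BT : T = Q^T *m Aopt *m Q.
  by rewrite mulmxDr mulmxDl -/Q mul_mx_scalar -scalemxAl QQ scalemx1.
have Ts : symmetric_mx T by rewrite BT; exact: symmetric_compress.
have Tp : posdef T by rewrite BT; exact: posdef_compress.
have Tu := posdef_unit Tp.
have ng0 : 0 < vnorm g by rewrite vnorm_gt0.
have gE : g = vnorm g *: q 0%N by rewrite q0E scalerA mulfV ?scale1r // gt_eqF.
have Qg : Q^T *m g = vnorm g *: e_first R k.+1.
  rewrite {1}gE -scalemxAr; congr (_ *: _).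
  have -> : q 0%N = Q *m e_first R k.+1.
    apply/colP => l; rewrite mxE (bigD1 ord0) //= big1 ?addr0 => [|j j0].
      by rewrite !mxE eqxx mulr1.
    by rewrite !mxE [_ == _](negPf j0) mulr0.
  by rewrite mulmxA QQ mul1mx.
have Tht : T *m htil = - (Q^T *m g).
  by rewrite Qg mulmxN -scalemxAr mulKVmx.
have Qr : Q^T *m rtil = 0.
  by rewrite mulmxDr !mulmxA -BT Tht addrC subrr.
have Kp (p : {poly R}) : (size p <= k.+1)%N -> ((horner_mx Aopt p *m g)^T <= Q^T)%MS.
  move=> sp; have /andP[_ K2] := QK k.+1 kk; apply: submx_trans K2.
  exact: horner_mx_shift_krylov.
have gQ : Q *m (Q^T *m g) = g.
  by apply: orthoproj_id => //; have := Kp 1; rewrite rmorph1 mul1mx size_poly1; apply.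
pose v := invmx Aopt *m xopt.
have Bv : Aopt *m v = xopt by rewrite mulKVmx.
have yn0 : y != 0 by rewrite -vnorm_eq0 y1 oner_eq0.
have [c c0 y2E] := Mmat_eigenvector Bu Bx Bv My yn0.
have vn0 : v != 0.
  apply: contraTneq D0 => v0; rewrite -xD -Bv v0 mulmx0.
  by rewrite -leNgt le_eqVlt vnorm_eq0 eqxx.
have nv0 : 0 < vnorm v by rewrite vnorm_gt0.
have y2n0 : 0 < vnorm y2 by rewrite /y2 y2E vnorm_gt0 scaler_eq0 negb_or c0.
(* [y2] and [v] are parallel, so the factor |v| in [sk] clears the denominator of the sine. *)
have sinE : sin_angle Q y2 * vnorm v = vnorm ((1%:M - Q *m Q^T) *m v).
  by rewrite /y2 y2E sin_angleZ // /sin_angle mulfVK // gt_eqF.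
pose E := ((e_first R k.+1)^T *m (Bk *m Bk *m Bk) *m e_first R k.+1) 0 0.
have htE : dotv htil (Bk *m htil) = vnorm g ^+ 2 * E.
  have Bks : Bk^T = Bk by exact: symmetric_inv.
  rewrite /htil mulmxN dotvNl dotvNr opprK -scalemxAr dotvZl dotvZr mulrA -expr2.
  congr (_ * _); rewrite dotvC dotv_mulmxr Bks dotvC.
  by rewrite /E /dotv !mulmxA.
have htn0 : htil != 0.
  apply: contraTneq ng0 => h0; rewrite h0 mulmx0 in Tht.
  have Qg0 : Q^T *m g = 0 by rewrite -[LHS]opprK -Tht oppr0.
  by rewrite -gQ Qg0 mulmx0 -leNgt le_eqVlt vnorm_eq0 eqxx.
have E0 : 0 < E.
  have := posdef_inv Tp htn0; rewrite -/Bk htE pmulr_rgt0 // exprn_gt0 //.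
have sk0 : 0 <= sk by rewrite divr_ge0 ?vnorm_ge0 // mulr_ge0 ?vnorm_ge0 // ltW.
split.
  have [dle|dgt] := leP (lamopt - lamk) 0.
    apply: le_trans dle _; rewrite mulr_ge0 ?sin_angle_ge0 // mulr_ge0 //.
    by rewrite divr_ge0 ?vnorm_ge0.
  (* For delta = lamopt - lamk the shifted matrix is the one that the optimality of [hk] makes
     positive semidefinite. *)
  have SE : T - (lamopt - lamk)%:M = Tk A q k.+1 + lamk%:M.
    by rewrite /T raddfB /= opprB -addrA [X in _ + X]addrC subrK.
  have gap1 : 2 * (lamopt - lamk) * (vnorm g ^+ 2 * E) <= dotv hk hk - dotv htil htil.
    rewrite -htE; apply: secular_convexity => //; rewrite ?SE ?(ltW dgt) //.
    by rewrite Tht Qg.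
  have gap2 := galerkin_norm_gap Bs Bx Bv Qr.
  (* The boundary conditions match the right side of [gap1] with the left side of [gap2]. *)
  have hx : dotv hk hk = dotv xopt xopt.
    by rewrite -!sqr_vnorm xD -hD vnorm_isometry.
  rewrite -hx -[dotv (Q *m htil) _]sqr_vnorm vnorm_isometry // sqr_vnorm in gap2.
  rewrite -/xtil -/rtil -sinE in gap2.
  have {gap1 gap2} gap := le_trans gap1 gap2.
  have -> : sk * (vnorm rtil / vnorm g) * sin_angle Q y2 =
      vnorm rtil * (sin_angle Q y2 * vnorm v) / (vnorm g ^+ 2 * E).
    rewrite /sk -/v -/E; field; by rewrite !gt_eqF.
  rewrite ler_pdivlMr ?mulr_gt0 ?exprn_gt0 //.
  by rewrite -(@ler_pM2l _ 2) // [X in X <= _]mulrA.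
have hbnd : vnorm htil <= D.
  by rewrite -xD; apply: (galerkin_norm_le Bs Bp QQ Kp Bx); rewrite -BT.
have ab : a <= b.
  have /andP[l1 l2] := rayleigh_bounds As ha hb g.
  by have := le_trans l1 l2; rewrite ler_pM2r ?lerD2r // lt0r dotvv_eq0 g0 dotvv_ge0.
have Tev t : eigenvalue T t -> a <= t <= b.
  rewrite BT; apply: compress_eigenvalue_bounds => // z /eigenvalue_shift => [/ha|/hb].
    by rewrite lerBrDr.
  by rewrite lerBlDr.
(* These are the coordinates of p(Aopt) g, a vector of the Krylov space of dimension at most k. *)
have last0 (p : {poly R}) : (size p <= k)%N -> (horner_mx T p *m (Q^T *m g)) ord_max 0 = 0.
  move=> sp; apply: (lanczos_last_entry0 lan kk); rewrite BT compress_horner //.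
    exact: horner_mx_shift_krylov.
  exact: leqW.
have rho0 : 0 <= rho ^+ k.
  have s1 : 1 <= Num.sqrt kappa.
    by rewrite -sqrtr1 ler_wsqrtr // ler_pdivlMr // mul1r.
  by rewrite exprn_ge0 // divr_ge0 ?subr_ge0 // addr_ge0 ?sqrtr_ge0.
have hlast : `|htil ord_max 0| <= 2 * rho ^+ k * D.
  apply: le_trans (galerkin_last_entry_le Ts a0 ab Tev last0 Tht) _.
  by rewrite ler_wpM2l // mulr_ge0.
(* Since g = - Q T htil, the residual is the Lanczos defect applied to [htil]; the two shifts
   cancel. *)
have rE : vnorm rtil = `|htil ord_max 0| * betak A q k.+1.
  rewrite /betak -vnormZ -(lanczos_recurrence _ As lan kk) -/Q; congr vnorm.
  rewrite /rtil mulmxBl -mulmxA mulmxDl mul_scalar_mx -addrA; congr (_ + _).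
  have : Q *m (T *m htil) = - g by rewrite Tht mulmxN gQ.
  rewrite mulmxDl mul_scalar_mx mulmxDr -scalemxAr -/xtil mulmxA => QTh.
  by rewrite -[X in _ + X]opprK -QTh opprD addrCA subrr addr0.
rewrite /=.
have := sin_angle_Qk2 q k.+1 y1; rewrite -/Q -/y2 => s2.
have b0 : 0 <= betak A q k.+1 by exact: vnorm_ge0.
(* The sine is multiplied and divided by |y2|, because [sin_angle_Qk2] bounds the product. *)
have -> : sk * (vnorm rtil / vnorm g) * sin_angle Q y2 =
   sk * (vnorm rtil / (vnorm y2 * vnorm g) * (sin_angle Q y2 * vnorm y2)).
  by field; rewrite !gt_eqF.
have -> : sk * (2 * betak A q k.+1 * D / (vnorm y2 * vnorm g)) * rho ^+ k *
      sin_angle (Qk2 q k.+1) y =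
    sk * (2 * rho ^+ k * D * betak A q k.+1 / (vnorm y2 * vnorm g) *
      sin_angle (Qk2 q k.+1) y).
  by field; rewrite !gt_eqF.
apply: ler_wpM2l => //; apply: ler_pM => //.
- by rewrite divr_ge0 ?vnorm_ge0 // mulr_ge0 ?vnorm_ge0.
- by rewrite mulr_ge0 ?sin_angle_ge0 ?vnorm_ge0.
by rewrite ler_pM2r ?invr_gt0 ?mulr_gt0 // rE ler_wpM2r.
Qed.
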